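(* Let $\mathsf{FES}_w\subset\mathcal{A}$ be the $\mathbb{Q}$-vector space generated by all finite Euler sums of weight $w$. Then the following are generating sets for $w<7$, where $\langle\cdots\rangle$ denotes the $\mathbb{Q}$-span in $\mathcal{A}$: $$\mathsf{FES}_1=\langle \mathtt{q}_2\rangle,\quad \mathsf{FES}_2=\langle \mathtt{q}_2^2\rangle,\quad \mathsf{FES}_3=\langle \mathtt{q}_2^3,\beta_3\rangle,\quad \mathsf{FES}_4=\langle \mathtt{q}_2^4,\ \mathtt{q}_2\beta_3,\ \zeta_{\mathcal{A}}(1,\bar3)\rangle,$$ $$\mathsf{FES}_5=\langle \mathtt{q}_2^5,\ \mathtt{q}_2^2\beta_3,\ \beta_5,\ \zeta_{\mathcal{A}}(\bar1,2,2),\ \zeta_{\mathcal{A}}(\bar1,\bar2,2)\rangle,$$ $$\mathsf{FES}_6=\langle \mathtt{q}_2^6,\ \mathtt{q}_2^3\beta_3,\ \beta_3^2,\ \mathtt{q}_2\beta_5,\ \zeta_{\mathcal{A}}(\bar1,1,2,2),\ \zeta_{\mathcal{A}}(\bar1,2,2,1),\ \zeta_{\mathcal{A}}(\bar1,2,1,2),\ \zeta_{\mathcal{A}}(\bar1,1,1,1,2)\rangle.$$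
   Context: $\mathbb{N}$ is the set of positive integers, $\mathcal{P}$ the set of primes, and $\mathcal{A}:=\prod_{p\in\mathcal{P}}(\mathbb{Z}/p\mathbb{Z})\big/\bigoplus_{p\in\mathcal{P}}(\mathbb{Z}/p\mathbb{Z})$, a $\mathbb{Q}$-algebra in which an element is determined by its components for all but finitely many $p$. Let $\mathbb{D}=\mathbb{N}\cup\bar{\mathbb{N}}$, where $\bar{\mathbb{N}}=\{\bar s: s\in\mathbb{N}\}$; for $s\in\mathbb{N}$ put $|s|=|\bar s|=s$, $\operatorname{sgn}(s)=1$, $\operatorname{sgn}(\bar s)=-1$. The finite Euler sum attached to $\mathbf{s}=(s_1,\dots,s_d)\in\mathbb{D}^d$ is $$\zeta_{\mathcal{A}}(\mathbf{s}):=\Bigg(\sum_{p>n_1>\dots>n_d>0}\ \prod_{j=1}^d\frac{\operatorname{sgn}(s_j)^{n_j}}{n_j^{|s_j|}}\ (\mathrm{mod}\ p)\Bigg)_{p\in\mathcal{P}}\in\mathcal{A},$$ and its weight is $|s_1|+\cdots+|s_d|$. $\mathtt{q}_2:=\big(\tfrac{2^{p-1}-1}{p}\ (\mathrm{mod}\ p)\big)_{3\le p\in\mathcal{P}}\in\mathcal{A}$ is the Fermat quotient, and for $w\ge2$, $\beta_w:=\big(\tfrac{B_{p-w}}{w}\ (\mathrm{mod}\ p)\big)_{w<p\in\mathcal{P}}\in\mathcal{A}$, where the Bernoulli numbers $B_n$ are defined by $\frac{t}{e^t-1}=\sum_{n\ge0}B_n\frac{t^n}{n!}$. *)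

(* Defs.v *)
From HB Require Import structures.
From mathcomp Require Import all_boot all_order all_algebra.
From mathcomp Require Import boolp classical_sets cardinality.

Set Implicit Arguments.
Unset Strict Implicit.
Unset Printing Implicit Defensive.

Import Order.TTheory GRing.Theory Num.Theory.
Local Open Scope ring_scope.
Local Open Scope classical_set_scope.
Local Open Scope quotient_scope.

Definition primeT : Type := {p : nat | prime p}.

Definition prodFp : Type := forall p : primeT, 'F_(val p).

HB.instance Definition _ := Choice.on prodFp.

Definition prodFp_add (f g : prodFp) : prodFp := fun p => f p + g p.
Definition prodFp_opp (f : prodFp) : prodFp := fun p => - f p.
Definition prodFp_mul (f g : prodFp) : prodFp := fun p => f p * g p.

Lemma prodFpP (f g : prodFp) : (forall p, f p = g p) -> f = g.
Proof. exact: functional_extensionality_dep. Qed.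

Fact prodFp_addA : associative prodFp_add.
Proof. by move=> f g h; apply: prodFpP => p; apply: addrA. Qed.
Fact prodFp_addC : commutative prodFp_add.
Proof. by move=> f g; apply: prodFpP => p; apply: addrC. Qed.
Fact prodFp_add0 : left_id ((fun=> 0) : prodFp) prodFp_add.
Proof. by move=> f; apply: prodFpP => p; apply: add0r. Qed.
Fact prodFp_addN : left_inverse ((fun=> 0) : prodFp) prodFp_opp prodFp_add.
Proof. by move=> f; apply: prodFpP => p; apply: addNr. Qed.

HB.instance Definition _ := GRing.isZmodule.Build prodFp
  prodFp_addA prodFp_addC prodFp_add0 prodFp_addN.

Fact prodFp_mulA : associative prodFp_mul.
Proof. by move=> f g h; apply: prodFpP => p; apply: mulrA. Qed.
Fact prodFp_mulC : commutative prodFp_mul.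
Proof. by move=> f g; apply: prodFpP => p; apply: mulrC. Qed.
Fact prodFp_mul1 : left_id ((fun=> 1) : prodFp) prodFp_mul.
Proof. by move=> f; apply: prodFpP => p; apply: mul1r. Qed.
Fact prodFp_mulDl : left_distributive prodFp_mul +%R.
Proof. by move=> f g h; apply: prodFpP => p; apply: mulrDl. Qed.
Fact prodFp_oner_neq0 : ((fun=> 1) : prodFp) != 0.
Proof.
apply/eqP => /(congr1 (fun f : prodFp => f (exist _ 2%N isT))) /eqP.
by rewrite oner_eq0.
Qed.

HB.instance Definition _ := GRing.Zmodule_isComNzRing.Build prodFp
  prodFp_mulA prodFp_mulC prodFp_mul1 prodFp_mulDl prodFp_oner_neq0.

Lemma prodFp0 p : (0 : prodFp) p = 0. Proof. by []. Qed.
Lemma prodFp1 p : (1 : prodFp) p = 1. Proof. by []. Qed.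
Lemma prodFpD (f g : prodFp) p : (f + g) p = f p + g p. Proof. by []. Qed.
Lemma prodFpN (f : prodFp) p : (- f) p = - f p. Proof. by []. Qed.
Lemma prodFpM (f g : prodFp) p : (f * g) p = f p * g p. Proof. by []. Qed.

(* The ideal "direct sum of the Z/pZ" of the product. *)
Definition sumFp (f : prodFp) : bool := `[< finite_set [set p | f p != 0] >].

Lemma infinite_primeT : ~ finite_set [set: primeT].
Proof.
move=> /finite_seqP[s sE].
have [p lt_p pr_p] := prime_above (\sum_(q <- s) val q).
have : [set: primeT] (exist _ p pr_p) by [].
rewrite sE /= => ps; move: lt_p.
by rewrite (big_rem _ ps) /= ltnNge leq_addr.
Qed.

Fact sumFp_idealr : idealr_closed (sumFp : {pred prodFp}).
Proof.
split.
- apply/asboolP; rewrite (_ : [set p | _] = set0) ?finite_set0 //.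
  by apply/seteqP; split=> // p /=; rewrite eqxx.
- apply/asboolPn; rewrite (_ : [set p | _] = setT); first exact: infinite_primeT.
  by apply/seteqP; split=> // p _ /=; rewrite oner_eq0.
- move=> a u v /asboolP fu /asboolP fv; apply/asboolP.
  have : finite_set ([set p | u p != 0] `|` [set p | v p != 0]).
    by rewrite finite_setU.
  apply: sub_finite_set => p /= auv0.
  have [u0|] := eqVneq (u p) 0; last by left.
  right; apply: contraNneq auv0 => v0.
  by rewrite prodFpD prodFpM u0 v0 mulr0 addr0.
Qed.

HB.instance Definition _ := isIdealr.Build prodFp sumFp sumFp_idealr.

Definition directsum : idealr prodFp := sumFp.

Definition calA : Type := {ideal_quot directsum}.

HB.instance Definition _ := GRing.ComNzRing.on calA.

Definition toA (f : prodFp) : calA := \pi_({ideal_quot directsum}) f.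

Definition reprA (x : calA) : prodFp := repr (x : {ideal_quot directsum}).

Lemma reprAK (x : calA) : toA (reprA x) = x.
Proof. exact: reprK. Qed.

Lemma toAP (f g : prodFp) : toA f = toA g <-> finite_set [set p | f p != g p].
Proof.
have -> : [set p | f p != g p] = [set p | (f - g) p != 0].
  by apply/seteqP; split=> p /=; rewrite prodFpD prodFpN subr_eq0.
rewrite /toA; split=> [/eqP|fg].
  by rewrite -Quotient.idealrBE => /asboolP.
by apply/eqP; rewrite -Quotient.idealrBE; apply/asboolP.
Qed.

Lemma toAD (f g : prodFp) : toA (f + g) = toA f + toA g.
Proof. exact: rmorphD (\pi_({ideal_quot directsum})) f g. Qed.
Lemma toAM (f g : prodFp) : toA (f * g) = toA f * toA g.
Proof. exact: rmorphM (\pi_({ideal_quot directsum})) f g. Qed.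

(* The residue mod p of a p-integral rational; junk if p divides denq r. *)
Definition rat_mod (p : nat) (r : rat) : 'F_p := ratr r.

Lemma ratr_fracE (F : fieldType) (r : rat) (n d : int) :
  (d%:~R : F) != 0 -> r = n%:~R / d%:~R -> ratr r = n%:~R / d%:~R :> F.
Proof.
move=> dF rE; rewrite /ratr.
have d0 : d != 0 by apply: contraNneq dF => ->.
have e : numq r * d = n * denq r.
  apply/eqP; rewrite -(eqr_int rat) !intrM.
  rewrite -{1}(divfK (_ : (denq r)%:~R != 0 :> rat) (numq r)%:~R) ?intr_eq0 ?denq_neq0 //.
  rewrite divq_num_den {1}rE; apply/eqP.
  by rewrite mulrAC divfK // intr_eq0.
have dvd : (denq r %| d)%Z.
  rewrite -(Gauss_dvdzr (n := numq r)); last first.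
    by rewrite coprimezE coprime_sym coprime_num_den.
  by rewrite e dvdz_mull.
have qF : ((denq r)%:~R : F) != 0.
  by apply: contraNneq dF => q0; case/dvdzP: dvd => k ->; rewrite intrM q0 mulr0.
by apply/eqP; rewrite eqr_div // -!intrM e.
Qed.

Lemma rat_modD p a b : (denq a)%:~R != 0 :> 'F_p -> (denq b)%:~R != 0 :> 'F_p ->
  rat_mod p (a + b) = rat_mod p a + rat_mod p b.
Proof.
move=> da db; rewrite /rat_mod.
rewrite (@ratr_fracE _ _ (numq a * denq b + numq b * denq a) (denq a * denq b)).
- by rewrite /ratr addf_div // !(intrD, intrM).
- by rewrite intrM mulf_neq0.
- rewrite -{1}(divq_num_den a) -{1}(divq_num_den b) addf_div ?intr_eq0 ?denq_neq0 //.
  by rewrite !(intrD, intrM).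
Qed.

Lemma rat_modM p a b : (denq a)%:~R != 0 :> 'F_p -> (denq b)%:~R != 0 :> 'F_p ->
  rat_mod p (a * b) = rat_mod p a * rat_mod p b.
Proof.
move=> da db; rewrite /rat_mod.
rewrite (@ratr_fracE _ _ (numq a * numq b) (denq a * denq b)).
- by rewrite /ratr mulf_div !intrM.
- by rewrite intrM mulf_neq0.
- by rewrite -{1}(divq_num_den a) -{1}(divq_num_den b) mulf_div !intrM.
Qed.

Lemma finite_dvd_primes (n : nat) : (0 < n)%N ->
  finite_set [set p : primeT | n%:R == 0 :> 'F_(val p)].
Proof.
move=> n0; apply: (@sub_finite_set _ _ [set p : primeT | (val p < n.+1)%N]).
  move=> p /=; rewrite -(dvdn_pcharf (pchar_Fp (valP p))) => /dvdn_leq.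
  by rewrite ltnS; apply.
apply: (@finite_preimage _ _ [set k | (k < n.+1)%N] (val : primeT -> nat)).
  by move=> p q _ _; apply: val_inj.
exact: finite_II.
Qed.

Lemma finite_denq (r : rat) :
  finite_set [set p : primeT | (denq r)%:~R == 0 :> 'F_(val p)].
Proof.
have -> : denq r = `|denq r|%N by rewrite gez0_abs // ltW // denq_gt0.
by apply: finite_dvd_primes; rewrite absz_gt0 denq_neq0.
Qed.

Definition prodFp_scale (r : rat) (f : prodFp) : prodFp :=
  fun p => rat_mod (val p) r * f p.

Definition calA_scale (r : rat) (x : calA) : calA :=
  toA (prodFp_scale r (reprA x)).

Lemma calA_scaleE r f : calA_scale r (toA f) = toA (prodFp_scale r f).
Proof.
apply/toAP; have /toAP := reprAK (toA f).
apply: sub_finite_set => p /=; apply: contraNneq => fE.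
by rewrite /prodFp_scale fE.
Qed.

Fact calA_scalerA a b x : calA_scale a (calA_scale b x) = calA_scale (a * b) x.
Proof.
rewrite -[x]reprAK !calA_scaleE; apply/toAP.
have := conj (finite_denq a) (finite_denq b); rewrite -finite_setU.
apply: sub_finite_set => p /=; have [/eqP a0|da] := eqVneq ((denq a)%:~R : 'F_(val p)) 0; first by left.
have [/eqP b0|db] := eqVneq ((denq b)%:~R : 'F_(val p)) 0; first by right.
by rewrite /prodFp_scale rat_modM // mulrA eqxx.
Qed.

Fact calA_scale1r : left_id 1 calA_scale.
Proof.
move=> x; rewrite -[x]reprAK calA_scaleE; congr toA; apply: prodFpP => p.
by rewrite /prodFp_scale /rat_mod (ratr_nat _ 1) mul1r.
Qed.

Fact calA_scalerDr : right_distributive calA_scale +%R.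
Proof.
move=> a x y; rewrite -[x]reprAK -[y]reprAK -toAD !calA_scaleE -toAD.
by congr toA; apply: prodFpP => p; apply: mulrDr.
Qed.

Fact calA_scalerDl x : {morph calA_scale^~ x : a b / a + b}.
Proof.
move=> a b; rewrite -[x]reprAK !calA_scaleE -toAD; apply/toAP.
have := conj (finite_denq a) (finite_denq b); rewrite -finite_setU.
apply: sub_finite_set => p /=; have [/eqP a0|da] := eqVneq ((denq a)%:~R : 'F_(val p)) 0; first by left.
have [/eqP b0|db] := eqVneq ((denq b)%:~R : 'F_(val p)) 0; first by right.
by rewrite prodFpD /prodFp_scale rat_modD // mulrDl eqxx.
Qed.

HB.instance Definition _ := GRing.Zmodule_isLmodule.Build rat calA
  calA_scalerA calA_scale1r calA_scalerDr calA_scalerDl.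

Lemma scale_toA r f : r *: toA f = toA (prodFp_scale r f).
Proof. exact: calA_scaleE. Qed.

Fact calA_scalerAl (a : rat) (x y : calA) : a *: (x * y) = (a *: x) * y.
Proof.
rewrite -[x]reprAK -[y]reprAK -toAM !scale_toA -toAM.
by congr toA; apply: prodFpP => p; apply: mulrA.
Qed.

HB.instance Definition _ := GRing.Lmodule_isLalgebra.Build rat calA calA_scalerAl.
HB.instance Definition _ := GRing.Lalgebra_isComAlgebra.Build rat calA.

Definition Qspan (V : lmodType rat) (S : set V) : set V :=
  [set x | exists (n : nat) (c : 'I_n -> rat) (v : 'I_n -> V),
     (forall i, S (v i)) /\ x = \sum_i c i *: v i].

(* The index set D is the set of [Plain s] (for s) and [Bar s] (for s barred)
   with s > 0; positivity is the separate predicate [is_index]. *)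
Inductive eindex : Type := Plain of nat | Bar of nat.

Definition eabs (s : eindex) : nat := match s with Plain k | Bar k => k end.

Definition esgn (R : pzRingType) (s : eindex) : R :=
  match s with Plain _ => 1 | Bar _ => -1 end.

Definition is_index (s : eindex) : bool := (0 < eabs s)%N.

Definition weight d (s : d.-tuple eindex) : nat := (\sum_(j < d) eabs (tnth s j))%N.

(* The path condition reads p > n_1 > ... > n_d > 0. *)
Definition euler_sum_mod (p d : nat) (s : d.-tuple eindex) : 'F_p :=
  \sum_(n : d.-tuple 'I_p | path gtn p (rcons [seq val i | i <- n] 0%N))
    \prod_(j < d) (esgn _ (tnth s j) ^+ (tnth n j : nat)
                   / (tnth n j : nat)%:R ^+ eabs (tnth s j)).

Definition zetaA d (s : d.-tuple eindex) : calA :=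
  toA (fun p => euler_sum_mod (val p) s).

Definition FES (w : nat) : set calA :=
  Qspan [set x | exists (d : nat) (s : d.-tuple eindex),
           [/\ all is_index s, weight s = w & x = zetaA s]].

(* The component at p = 2 is junk, and irrelevant in [calA]. *)
Definition q2 : calA :=
  toA (fun p => rat_mod (val p) ((2 ^+ (val p).-1 - 1) / (val p)%:R)).

(* [bern_coefs n] lists the first n coefficients b_k = B_k / k! of the power
   series t / (e^t - 1), i.e. of the inverse of sum_k t^k / (k+1)!. *)
Fixpoint bern_coefs (n : nat) : seq rat :=
  if n is m.+1 then
    let b := bern_coefs m in
    rcons b ((m == 0%N)%:R - \sum_(k < m) b`_k / (m - k).+1`!%:R)
  else [::].

Definition bernoulli (n : nat) : rat := n`!%:R * (bern_coefs n.+1)`_n.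

Lemma size_bern_coefs n : size (bern_coefs n) = n.
Proof. by elim: n => //= n IHn; rewrite size_rcons IHn. Qed.

Lemma nth_bern_coefs n k : (k < n)%N -> (bern_coefs n)`_k = bernoulli k / k`!%:R.
Proof.
have f0 : k`!%:R != 0 :> rat by rewrite pnatr_eq0 -lt0n fact_gt0.
move=> kn; rewrite /bernoulli mulrC mulKf //.
elim: n kn => // n IHn; rewrite ltnS leq_eqVlt => /orP[/eqP <- //|kn].
by rewrite /= nth_rcons size_bern_coefs kn IHn.
Qed.

(* Coefficient of t^n in (sum_k B_k t^k / k!) * (e^t - 1) = t. *)
Lemma bernoulli_egf (n : nat) :
  \sum_(k < n) bernoulli k / k`!%:R * (n - k)`!%:R^-1 = (n == 1%N)%:R.
Proof.
case: n => [|n]; first by rewrite big_ord0.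
rewrite big_ord_recr /= subSnn invr1 mulr1 -(@nth_bern_coefs n.+1) //=.
rewrite nth_rcons size_bern_coefs ltnn eqxx eqSS addrC.
rewrite -[RHS](subrK (\sum_(k < n) (bern_coefs n)`_k / (n - k).+1`!%:R)).
by congr +%R; apply: eq_bigr => k _; rewrite nth_bern_coefs // subSn // ltnW.
Qed.

(* Meaningful for w >= 2; the components at p <= w are irrelevant. *)
Definition beta (w : nat) : calA :=
  toA (fun p => if (w < val p)%N
                then rat_mod (val p) (bernoulli (val p - w) / w%:R) else 0).

(* Main.v *)
(* Let Z(u) in A be the finite Euler sum of the word u. Double
   shuffle relations hold modulo every prime p: the stuffle product of
   nested sums gives Z(u) Z(v) = sum of Z over the stuffles of u and v; and the
   shuffle product of the polylogarithm series of u and v, whose coefficients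
   below t^p are summed after the substitution n -> p - n in the indices of v,
   gives sum of Z over the shuffles of u and v = +- Z(reverse(v) u) (for empty u
   this is the reversal relation). Moreover q_2 = -Z(bar 1)/2, from
   binom(p, k)/p = (-1)^(k-1)/k mod p, and beta_w = -Z(1, w-1)/w, from Faulhaber's
   formula. So products of the generators are rational combinations of the Z(u)
   with |u| = w, and in each weight w <= 6 a family of double shuffle relations
   together with these combinations spans the space on the 2 * 3^(w-1) words of
   weight w; this is checked by Gaussian elimination over Z inside the kernel. *)

Require Import Defs.
From Stdlib Require Import ZArith.
From HB Require Import structures.
From mathcomp Require Import all_boot all_order all_algebra.
From mathcomp Require Import boolp classical_sets cardinality.
From mathcomp Require Import finfield ssrZ zify ring.

Set Implicit Arguments.
Unset Strict Implicit.
Unset Printing Implicit Defensive.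

Import Order.TTheory GRing.Theory Num.Theory.
Local Open Scope ring_scope.

Definition word := seq eindex.

(** * Stuffle and shuffle relations modulo p *)

Section HarmonicSums.
Variable F : fieldType.
Implicit Types (a b : eindex) (u v : word) (m n : nat).

Definition term a n : F := esgn F a ^+ n / n%:R ^+ eabs a.

(** The range starts at 0, but [term a 0] is 0 for [is_index a] because 0 has inverse 0; so only
    chains m > n_1 > ... > n_d > 0 contribute. *)
Fixpoint hsum u m : F :=
  if u is a :: u' then \sum_(0 <= n < m) term a n * hsum u' n else 1.

Lemma term0 a : is_index a -> term a 0 = 0.
Proof. by rewrite /term /is_index expr0n; case: (eabs a) => // k _; rewrite invr0 mulr0. Qed.

Definition index_add a b : eindex :=
  match a, b with
  | Plain j, Plain k | Bar j, Bar k => Plain (j + k)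
  | Plain j, Bar k | Bar j, Plain k => Bar (j + k)
  end.

Lemma term_mul a b n : term a n * term b n = term (index_add a b) n.
Proof.
rewrite /term mulf_div -exprMn -exprD.
by case: a => j; case: b => k /=; rewrite ?(mul1r, mulr1, mulrNN).
Qed.

Fixpoint stuffle u : word -> seq word :=
  if u is a :: u' then
    fix stuffle_u v := if v is b :: v' then
      map (cons a) (stuffle u' v) ++ map (cons b) (stuffle_u v')
      ++ map (cons (index_add a b)) (stuffle u' v')
    else [:: u]
  else fun v => [:: v].

Lemma hsum_sum_cons a (s : seq word) m :
  \sum_(w <- map (cons a) s) hsum w m
  = \sum_(0 <= n < m) term a n * \sum_(w <- s) hsum w n.
Proof.
rewrite big_map exchange_big /=; apply: eq_bigr => n _.
by rewrite mulr_sumr.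
Qed.

(** The three kinds of stuffles match the three ways of comparing the largest indices of the two
    sums. *)
Lemma hsum_stuffle u v m :
  hsum u m * hsum v m = \sum_(w <- stuffle u v) hsum w m.
Proof.
elim: u v m => [|a u IHu] v m; first by rewrite big_seq1 mul1r.
elim: v m => [|b v IHv] m; first by rewrite big_seq1 mulr1.
rewrite /= !big_cat /= !hsum_sum_cons.
rewrite -!big_split /=.
transitivity (\sum_(0 <= n < m) (term a n * (hsum u n * hsum (b :: v) n) +
   (term b n * (hsum (a :: u) n * hsum v n) +
    term (index_add a b) n * (hsum u n * hsum v n)))); last first.
  by apply: eq_bigr => n _; rewrite -!IHu -IHv.
(* Discrete Leibniz rule: from m to m + 1 the product fg grows by (df)g + f(dg) + (df)(dg). *)
elim: m => [|m IHm]; first by rewrite !big_geq ?mul0r.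
rewrite [RHS]big_nat_recr //= -IHm !big_nat_recr //= -term_mul.
by ring.
Qed.

End HarmonicSums.

(** * Reflection of indices and the shuffle relation modulo p *)

Section Shuffle.
Variables (p : nat).
Hypothesis pr_p : prime p.
Local Notation F := 'F_p.
Local Notation term := (term F).
Local Notation hsum := (hsum F).
Implicit Types (a b : eindex) (u v : word) (m n : nat).

Lemma Fp_nat_neq0 n : (0 < n < p)%N -> n%:R != 0 :> F.
Proof.
case/andP=> n0 np; rewrite -(dvdn_pcharf (pchar_Fp pr_p)).
by apply: contraL np => /(dvdn_leq n0); rewrite leqNgt.
Qed.

Definition esign a : F := esgn F a * (-1) ^+ eabs a.

Lemma Fp_natB n : (n <= p)%N -> (p - n)%:R = - n%:R :> F.
Proof. by move=> np; rewrite natrB // pchar_Fp_0 // sub0r. Qed.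

Lemma term_reflect a n : (n <= p)%N -> term a (p - n) = esign a * term a n.
Proof.
move=> np; rewrite /term /esign Fp_natB // (exprNn n%:R) invfM.
(* Fermat's little theorem, which also covers p = 2. *)
have sgnp : esgn F a ^+ p = esgn F a by rewrite -{2}(expf_card (esgn F a)) card_Fp.
have sgnK : esgn F a ^+ n * esgn F a ^+ n = 1.
  by rewrite -exprMn; case: (a) => k /=; rewrite ?mulrNN mulr1 expr1n.
have -> : esgn F a ^+ (p - n) = esgn F a * esgn F a ^+ n.
  by rewrite -[LHS]mulr1 -sgnK mulrA -exprD subnK // sgnp.
by rewrite invr_sign mulrACA.
Qed.

Fixpoint hsum_above v n : F :=
  if v is b :: v' then \sum_(n.+1 <= k < p) term b k * hsum_above v' k else 1.

Definition word_sign v : F := \prod_(b <- v) esign b.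

(** Replacing each index k by p - k turns a decreasing chain below p - n into an increasing chain
    above n, at the cost of one [esign] per letter. *)
Lemma hsum_above_reflect v n : all is_index v -> (n <= p)%N ->
  hsum v (p - n) = word_sign v * hsum_above v n.
Proof.
rewrite /word_sign; elim: v n => [|b v IHv] n /=; first by rewrite big_nil mulr1.
case/andP=> b_ok v_ok np; rewrite big_cons mulr_sumr.
have [->|n_lt] := eqVneq n p; first by rewrite subnn !big_geq.
have {n_lt} n_lt : (n < p)%N by rewrite ltn_neqAle n_lt.
rewrite -[in LHS](subnSK n_lt) big_nat_recl // term0 // mul0r add0r.
have shift (G : nat -> F) : \sum_(n.+1 <= k < p) G k = \sum_(0 <= k < p - n.+1) G (k + n.+1)%N.
  by rewrite -{1}[n.+1]add0n big_addn.
rewrite shift big_nat_rev /= add0n big_nat [in RHS]big_nat.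
apply: eq_bigr => k /andP[_ kn].
have -> : ((p - n.+1 - k.+1).+1 = p - (k + n.+1))%N by lia.
have kp : (k + n.+1 <= p)%N by lia.
by rewrite IHv // term_reflect //; ring.
Qed.

(** The indices of v above n and those of u below n form one chain through n; the induction makes
    the first index of v the new middle one. *)
Lemma hsum_catrev a u v :
  \sum_(0 <= n < p) term a n * (hsum_above v n * hsum u n)
  = hsum (catrev v (a :: u)) p.
Proof.
elim: v a u => [|b v IHv] a u /=.
  by apply: eq_bigr => n _; rewrite mul1r.
rewrite -IHv /=.
transitivity (\sum_(0 <= n < p) \sum_(0 <= k < p | (n < k)%N)
    term b k * hsum_above v k * (term a n * hsum u n)).
  apply: eq_bigr => n _; rewrite mulrCA mulr_suml.
  by rewrite (big_nat_widenl _ 0%N) //=; apply: eq_bigr => k _; ring.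
rewrite (exchange_big_dep_nat xpredT) //= big_nat [RHS]big_nat; apply: eq_bigr => k /andP[_ kp].
rewrite !mulr_sumr [RHS](big_nat_widen _ _ p) //=; last exact: ltnW.
by apply: eq_bigr => n _; ring.
Qed.

(* Letters of iterated integrals: None is the form dt/t and Some e the form
   eps dt/(1 - eps t) with eps = (-1)^e. *)
Definition xword := seq (option bool).
Implicit Types (e : bool) (w : xword) (l : option bool).

Definition act l (f : nat -> F) n : F :=
  if l is Some e then \sum_(0 <= k < n) ((-1) ^+ e) ^+ (n - k) * f k else f n.

(* The coefficient of t^n in the iterated integral of w from 0 to t; at n = 0 the
   division by 0 gives the correct value 0. *)
Fixpoint coef w n : F :=
  if w is l :: w' then act l (coef w') n / n%:R else (n == 0%N)%:R.

Definition conv (f g : nat -> F) n : F := \sum_(0 <= k < n.+1) f k * g (n - k)%N.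

Lemma convC f g n : conv f g n = conv g f n.
Proof.
rewrite /conv big_nat_rev /= !big_nat; apply: eq_bigr => k /andP[_ kn].
by rewrite add0n subSS subKn // mulrC.
Qed.

Lemma conv1 f n : conv (coef [::]) f n = f n.
Proof.
rewrite /conv big_nat_recl //= subn0 mul1r big1 ?addr0 // => k _.
by rewrite mul0r.
Qed.

Lemma actS e f n : act (Some e) f n.+1 = (-1) ^+ e * (act (Some e) f n + f n).
Proof.
rewrite /= big_nat_recr //= subSnn expr1 mulrDr; congr (_ + _).
rewrite mulr_sumr !big_nat; apply: eq_bigr => k /andP[_ kn].
by rewrite subSn ?(ltnW kn) // exprS mulrA.
Qed.

(** [act l] multiplies the generating series by a fixed series: 1 for [None], eps t/(1 - eps t) for
    [Some e]. *)
Lemma conv_act l f g n : conv (act l f) g n = act l (conv f g) n.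
Proof.
case: l => [e|] //; elim: n => [|n IHn].
  by rewrite /conv big_nat1 /= !big_geq // mul0r.
rewrite actS -IHn /conv big_nat_recl // [act _ _ 0]big_geq // mul0r add0r.
rewrite -big_split mulr_sumr; apply: eq_bigr => k _.
by rewrite actS subSS -mulrA mulrDl.
Qed.

Lemma eq_conv f f' g g' n : (forall k, (k <= n)%N -> f k = f' k) ->
  (forall k, (k <= n)%N -> g k = g' k) -> conv f g n = conv f' g' n.
Proof.
move=> ff gg; rewrite /conv !big_nat; apply: eq_bigr => k /andP[_ kn].
by rewrite ff // gg // leq_subr.
Qed.

Fixpoint xshuffle (u : xword) : xword -> seq xword :=
  if u is a :: u' then
    fix xshuffle_u (v : xword) := if v is b :: v' then
      map (cons a) (xshuffle u' v) ++ map (cons b) (xshuffle_u v')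
    else [:: u]
  else fun v : xword => [:: v].

(** Excludes a final dt/t, whose integral diverges at 0; the default letter makes the empty word
    admissible. *)
Definition admissible w : bool := last (Some true) w != None.

Lemma admissible_behead l w : admissible (l :: w) -> admissible w.
Proof. by case: w. Qed.

Lemma last_xshuffle l (u v w : xword) : w \in xshuffle u v ->
  last l w = last l u \/ last l w = last l v.
Proof.
elim: u l v w => [|a u IHu] l v w; first by rewrite inE => /eqP ->; right.
elim: v l w => [|b v IHv] l w; first by rewrite inE => /eqP ->; left.
rewrite mem_cat => /orP[] /mapP[w' /= w'P ->] /=; first exact: IHu w'P.
exact: IHv w'P.
Qed.

Lemma admissible_xshuffle (u v w : xword) :
  admissible u -> admissible v -> w \in xshuffle u v -> admissible w.
Proof. by rewrite /admissible => uP vP /(last_xshuffle (Some true))[] ->. Qed.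

Lemma coef_cons0 l w : coef (l :: w) 0 = 0.
Proof. by rewrite /= invr0 mulr0. Qed.

Lemma mulr_coef l w n : admissible (l :: w) -> (n < p)%N ->
  n%:R * coef (l :: w) n = act l (coef w) n.
Proof.
move=> lw np; have [->|n0] := eqVneq n 0%N.
  rewrite mul0r; case: l lw => [e|] lw /=; first by rewrite big_geq.
  (* After dt/t the rest of an admissible word is nonempty, so its constant coefficient is 0. *)
  by case: w lw => // l' w _; rewrite coef_cons0.
by rewrite mulrC divfK // Fp_nat_neq0 // lt0n n0.
Qed.

Lemma sum_coef_cons l (s : seq xword) n :
  \sum_(w <- map (cons l) s) coef w n
  = act l (fun k => \sum_(w <- s) coef w k) n / n%:R.
Proof.
rewrite big_map -mulr_suml; congr (_ / _); case: l => [e|] //=.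
by rewrite exchange_big; apply: eq_bigr => k _; rewrite mulr_sumr.
Qed.

Lemma eq_act l (f g : nat -> F) n : (forall k, (k <= n)%N -> f k = g k) ->
  act l f n = act l g n.
Proof.
move=> fg; case: l => [e|] /=; last exact: fg.
by rewrite !big_nat; apply: eq_bigr => k /andP[_ /ltnW kn]; rewrite fg.
Qed.

(* Multiplying the n-th coefficient by n is the derivation t d/dt, which removes
   the first letter; it can be undone below p, where n is invertible. *)
Lemma coef_xshuffle (u v : xword) n : admissible u -> admissible v -> (n < p)%N ->
  conv (coef u) (coef v) n = \sum_(w <- xshuffle u v) coef w n.
Proof.
elim: u v n => [|a u IHu] v n; first by move=> *; rewrite big_seq1 conv1.
elim: v n => [|b v IHv] n; first by move=> *; rewrite big_seq1 convC conv1.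
move=> uP vP np; have [->|n0] := eqVneq n 0%N.
  rewrite /conv big_nat1 coef_cons0 mul0r /= big_cat /= !sum_coef_cons.
  by rewrite invr0 !mulr0 addr0.
have nF : n%:R != 0 :> F by rewrite Fp_nat_neq0 // lt0n n0.
apply: (mulfI nF); rewrite [in RHS]/= big_cat /= !sum_coef_cons -mulrDl.
rewrite [RHS]mulrC divfK //.
(* Leibniz rule: n = k + (n - k) in the k-th term of the convolution. *)
transitivity (conv (act a (coef u)) (coef (b :: v)) n +
              conv (coef (a :: u)) (act b (coef v)) n).
  rewrite /conv mulr_sumr -big_split !big_nat; apply: eq_bigr => k /andP[_ kn].
  transitivity (k%:R * coef (a :: u) k * coef (b :: v) (n - k)
                + coef (a :: u) k * ((n - k)%:R * coef (b :: v) (n - k))); last first.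
    by rewrite !mulr_coef ?(leq_ltn_trans _ np) ?leq_subr.
  have -> : n%:R = k%:R + (n - k)%:R :> F by rewrite -natrD subnKC.
  rewrite -[LHS]/((k%:R + (n - k)%:R) * (coef (a :: u) k * coef (b :: v) (n - k))).
  by rewrite mulrDl mulrA; congr (_ + _); rewrite mulrCA.
rewrite conv_act [X in _ + X]convC conv_act; congr (_ + _); apply: eq_act => k kn.
  by apply: IHu => //; [exact: admissible_behead uP | exact: leq_ltn_trans np].
by rewrite convC; apply: IHv => //; [exact: admissible_behead vP | exact: leq_ltn_trans np].
Qed.

(** * Translation between index words and words of differential forms *)

Definition is_bar a := if a is Bar _ then true else false.

Lemma esgnE a : esgn F a = (-1) ^+ is_bar a.
Proof. by case: a. Qed.

(* The iterated integral with letters eps_1, ..., eps_d has coefficients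
   prod_j eps_j^(n_j - n_(j+1)), so that the signs of the Euler sum are quotients
   of consecutive eps_j; [e] carries the previous one. *)
Fixpoint to_xword e u : xword :=
  if u is a :: u' then
    nseq (eabs a).-1 None ++ Some (e (+) is_bar a) :: to_xword (e (+) is_bar a) u'
  else [::].

(** Started at [k] = 1, it reads back what [to_xword] writes: [k] is one more than the number of
    letters dt/t just read, and [e] is the previous sign. *)
Fixpoint of_xword k e w : word :=
  match w with
  | [::] => [::]
  | None :: w' => of_xword k.+1 e w'
  | Some e' :: w' => (if e (+) e' then Bar k else Plain k) :: of_xword 1 e' w'
  end.

(** The part of the nested sum with largest index n, that is, the n-th coefficient of the
    polylogarithm of u; the empty word gives the constant series 1. *)
Definition hcoef u n : F :=
  if u is a :: u' then term a n * hsum u' n else (n == 0%N)%:R.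

Lemma sum_hcoef u m : (0 < m)%N -> \sum_(0 <= n < m) hcoef u n = hsum u m.
Proof.
case: u => //= m0; rewrite -(prednK m0) big_nat_recl // big1 ?addr0 //.
Qed.

Lemma coef_nseq k w n : coef (nseq k None ++ w) n = coef w n / n%:R ^+ k.
Proof.
elim: k => [|k IHk] /=; first by rewrite expr0 divr1.
by rewrite IHk -mulrA -invfM -exprSr.
Qed.

(** The twist eps^(n - k) of the letter and the factor eps^k of the rest combine to eps^n, leaving a
    partial sum of [hcoef u]. *)
Lemma coef_Some e w u n : (forall m, coef w m = ((-1) ^+ e) ^+ m * hcoef u m) ->
  coef (Some e :: w) n = ((-1) ^+ e) ^+ n * hsum u n / n%:R.
Proof.
move=> wE /=; have [->|n0] := posnP n; first by rewrite invr0 !mulr0.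
congr (_ / _); rewrite -sum_hcoef // mulr_sumr !big_nat.
by apply: eq_bigr => k /andP[_ /ltnW kn]; rewrite wE mulrA -exprD subnK.
Qed.

Lemma coef_to_xword e u n : all is_index u ->
  coef (to_xword e u) n = ((-1) ^+ e) ^+ n * hcoef u n.
Proof.
elim: u e n => [|a u IHu] e n /=.
  by case: n => [|n]; rewrite ?mulr0 // expr0 mulr1.
case/andP=> a0 uP; rewrite coef_nseq (coef_Some _ (u := u)); last first.
  by move=> m; apply: IHu.
rewrite /term esgnE -!mulrA -invfM -exprS prednK //.
by rewrite signr_addb exprMn -!mulrA; congr (_ * (_ * _)); rewrite mulrC.
Qed.

(** The letters dt/t counted by [k] stay in front of [w], so the induction can move them across one
    at a time; the condition on [last] is admissibility of that whole word. *)
Lemma coef_of_xword k e w n : (0 < k)%N ->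
  last (if k == 1%N then Some true else None) w != None ->
  coef (nseq k.-1 None ++ w) n = ((-1) ^+ e) ^+ n * hcoef (of_xword k e w) n.
Proof.
elim: w k e n => [|[e'|] w IHw] k e n k0 /=.
- by case: (k =P 1%N) => [->|] //= _; case: n => [|n]; rewrite ?mulr0 // expr0 mulr1.
- move=> wP; rewrite coef_nseq (coef_Some _ (u := of_xword 1 e' w)); last first.
    by move=> m; apply: (IHw 1%N) => //; case: (w) wP.
  rewrite /term esgnE -!mulrA -invfM -exprS prednK //.
  have -> : is_bar (if e (+) e' then Bar k else Plain k) = e (+) e' by case: ifP.
  have -> : eabs (if e (+) e' then Bar k else Plain k) = k by case: ifP.
  rewrite [RHS]mulrA -exprMn -signr_addb addbA addbb.
  by congr (_ * _); rewrite mulrC.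
- move=> wP; rewrite -(IHw k.+1) //=; last by rewrite eqSS (gtn_eqF k0).
  by case: k k0 {wP} => // k _; rewrite !coef_nseq /= exprS invfM mulrA.
Qed.

Lemma admissible_to_xword e u : admissible (to_xword e u).
Proof.
rewrite /admissible; elim: u e (Some true) (isT : Some true != None) => //= a u IHu e l lP.
by rewrite last_cat /=; apply: IHu.
Qed.

Definition shuffle u v : seq word :=
  map (of_xword 1 false) (xshuffle (to_xword false u) (to_xword false v)).

(** Summing the coefficients of the product below t^p gives the sum over k of [hsum u k] times
    [hcoef v (p - k)]; reflection puts the indices of v at or above k, and [hsum_catrev] joins the
    two chains. *)
Lemma hsum_shuffle u v : all is_index u -> all is_index v ->
  \sum_(w <- shuffle u v) hsum w p = word_sign v * hsum (catrev v u) p.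
Proof.
move=> uP vP; have p0 := prime_gt0 pr_p.
transitivity (\sum_(0 <= n < p) conv (hcoef u) (hcoef v) n).
  rewrite big_map; transitivity (\sum_(w <- xshuffle (to_xword false u) (to_xword false v))
      \sum_(0 <= n < p) coef w n).
    rewrite !big_seq; apply: eq_bigr => w /admissible_xshuffle wP.
    rewrite -sum_hcoef //; apply: eq_bigr => n _.
    have /= -> := @coef_of_xword 1 false w n isT; first by rewrite expr1n mul1r.
    by apply: wP; apply: admissible_to_xword.
  rewrite exchange_big !big_nat; apply: eq_bigr => n /andP[_ np].
  rewrite -coef_xshuffle ?admissible_to_xword //.
  by apply: eq_conv => k _; rewrite coef_to_xword // expr1n mul1r.
(* [act (Some false)] takes partial sums. *)
transitivity (act (Some false) (conv (hcoef u) (hcoef v)) p).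
  by apply: eq_bigr => n _; rewrite expr1n mul1r.
rewrite -conv_act.
have sumE n : (0 < n)%N -> act (Some false) (hcoef u) n = hsum u n.
  by move=> n0; rewrite -sum_hcoef //; apply: eq_bigr => k _; rewrite expr1n mul1r.
case: v vP => [|b v] /= => [_|/andP[b0 vP]].
  by rewrite convC [LHS]conv1 sumE // /word_sign big_nil mul1r.
(* The term k = p drops out because [term b 0] is 0. *)
rewrite -hsum_catrev mulr_sumr /conv big_nat_recr //= subnn term0 // mul0r mulr0 addr0.
rewrite !big_nat; apply: eq_bigr => k /andP[_ kp].
(* At k = 0 the empty partial sum differs from [hsum u 0] when u is empty, but the factor [term b 0]
   vanishes. *)
have [->|k0] := posnP k; first by rewrite big_geq // term0 // !(mul0r, mulr0).
rewrite -/(act (Some false) (hcoef u) k) sumE // term_reflect ?(ltnW kp) //.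
rewrite hsum_above_reflect ?(ltnW kp) // /word_sign big_cons.
by ring.
Qed.

End Shuffle.

(** * Relations as integer rows, and their elimination *)

(* Any total order would do; this one keeps the coefficients of the echelon form
   small. *)
Definition index_cmp (a b : eindex) : comparison :=
  match Nat.compare (eabs b) (eabs a) with
  | Eq => match a, b with
          | Bar _, Plain _ => Lt
          | Plain _, Bar _ => Gt
          | _, _ => Eq
          end
  | c => c
  end.

Fixpoint word_cmp (u v : word) : comparison :=
  match u, v with
  | [::], [::] => Eq
  | [::], _ :: _ => Lt
  | _ :: _, [::] => Gt
  | a :: u', b :: v' => if index_cmp a b is Eq then word_cmp u' v' else index_cmp a b
  end.

Definition word_row := seq (Z * word).

Fixpoint add_rows (x : word_row) : word_row -> word_row :=
  if x is (c, u) :: x' then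
    fix add_x (y : word_row) := if y is (d, v) :: y' then
      match word_cmp u v with
      | Lt => (c, u) :: add_rows x' y
      | Gt => (d, v) :: add_x y'
      | Eq => let e := Z.add c d in
              if Z.eqb e Z0 then add_rows x' y' else (e, u) :: add_rows x' y'
      end
    else x
  else fun y => y.

Definition scale_row (c : Z) (x : word_row) : word_row := [seq (Z.mul c t.1, t.2) | t <- x].

Definition row_of_words (s : seq word) : word_row :=
  foldr (fun u => add_rows [:: (Z.one, u)]) [::] s.

Definition mul_row (m : word) (x : word_row) : word_row :=
  foldr (fun t => add_rows (scale_row t.1 (row_of_words (stuffle m t.2)))) [::] x.

Definition prod_row (s : seq word) : word_row := foldr mul_row [:: (Z.one, [::])] s.

Definition sign_exp (v : word) : nat := sumn [seq (is_bar a + eabs a)%N | a <- v].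

(** The zero row for other words makes every [shuffle_row] evaluate to 0. *)
Definition shuffle_row (u v : word) : word_row :=
  if all is_index u && all is_index v then
    add_rows (row_of_words (shuffle u v))
      [:: (if odd (sign_exp v) then Z.one else Z.opp Z.one, catrev v u)]
  else [::].

Definition incr_head (u : word) : word :=
  match u with
  | [::] => [::]
  | Plain k :: u' => Plain k.+1 :: u'
  | Bar k :: u' => Bar k.+1 :: u'
  end.

(** A word of weight > 1 starts with 1 or bar 1, which can be removed if letters remain, or its
    first letter can be lowered by 1. Weight 1 is separate because the empty word has no letter to
    raise. *)
Fixpoint words (w : nat) : seq word :=
  if w is w'.+1 then
    if w' is 0 then [:: [:: Plain 1]; [:: Bar 1]] else
    flatten [seq [:: Plain 1 :: u; Bar 1 :: u; incr_head u] | u <- words w']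
  else [:: [::]].

Definition short_words (j : nat) : seq word :=
  if j is 0 then [:: [::]] else [:: [:: Plain j]; [:: Bar j]].

Definition shuffle_rows (j w : nat) : seq word_row :=
  [seq shuffle_row u v | u <- short_words j, v <- words (w - j)].

(* Much smaller than the family of all double shuffle relations, but of the same
   rank for w <= 6. *)
Definition relation_rows (w : nat) : seq word_row :=
  flatten [seq shuffle_rows j w | j <- iota 0 w] ++
  [seq mul_row m r | m <- short_words 1, r <- shuffle_rows 0 w.-1 ++ shuffle_rows 1 w.-1].

(* [ps] is sorted by leading words, which are pairwise distinct. *)
Fixpoint insert_row (ps : seq word_row) (x : word_row) : seq word_row :=
  match ps, x with
  | _, [::] => ps
  | [::], _ => [:: x]
  | [::] :: _, _ => ps
  | ((d, v) :: _) as p :: ps', (c, u) :: _ =>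
    match word_cmp u v with
    | Lt => x :: ps
    | Gt => p :: insert_row ps' x
    | Eq => let g := Z.gcd c d in
            p :: insert_row ps' (add_rows (scale_row (Z.div d g) x)
                                          (scale_row (Z.opp (Z.div c g)) p))
    end
  end.

Definition echelon (rs : seq word_row) : seq word_row := foldl insert_row [::] rs.

(* A list of words stands for the product of their Euler sums. *)
Definition gens (w : nat) : seq (seq word) :=
  let q := [:: Bar 1] in
  let b3 := [:: Plain 1; Plain 2] in
  let b5 := [:: Plain 1; Plain 4] in
  match w with
  | 1 => [:: [:: q]]
  | 2 => [:: [:: q; q]]
  | 3 => [:: [:: q; q; q]; [:: b3]]
  | 4 => [:: [:: q; q; q; q]; [:: q; b3]; [:: [:: Plain 1; Bar 3]]]
  | 5 => [:: [:: q; q; q; q; q]; [:: q; q; b3]; [:: b5];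
             [:: [:: Bar 1; Plain 2; Plain 2]]; [:: [:: Bar 1; Bar 2; Plain 2]]]
  | 6 => [:: [:: q; q; q; q; q; q]; [:: q; q; q; b3]; [:: b3; b3]; [:: q; b5];
             [:: [:: Bar 1; Plain 1; Plain 2; Plain 2]];
             [:: [:: Bar 1; Plain 2; Plain 2; Plain 1]];
             [:: [:: Bar 1; Plain 2; Plain 1; Plain 2]];
             [:: [:: Bar 1; Plain 1; Plain 1; Plain 1; Plain 2]]]
  | _ => [::]
  end.

Definition eindex_code (a : eindex) : nat + nat :=
  match a with Plain k => inl k | Bar k => inr k end.

Definition eindex_decode (c : nat + nat) : eindex :=
  match c with inl k => Plain k | inr k => Bar k end.

Lemma eindex_codeK : cancel eindex_code eindex_decode.
Proof. by case. Qed.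

HB.instance Definition _ := Equality.copy eindex (can_type eindex_codeK).

(* The words whose Euler sums are determined by the rows, read from the last row
   upwards. *)
Fixpoint solved (ps : seq word_row) : seq word :=
  if ps is p :: ps' then
    let s := solved ps' in
    if p is (c, u) :: p' then
      if ~~ Z.eqb c Z0 && all (fun t => t.2 \in s) p' then u :: s else s
    else s
  else [::].

(** Relation rows evaluate to 0 and generator rows to products of generators, so once all words are
    solved every Euler sum of weight w lies in the span of these products. *)
Definition full_rank (w : nat) : bool :=
  let s := solved (echelon (relation_rows w ++ map prod_row (gens w))) in
  all (fun u => u \in s) (words w).

(** * Finite Euler sums as elements of the algebra A *)

Section EulerSums.
Local Open Scope quotient_scope.

Lemma big_cons_tuple (R : nmodType) (T : finType) d
    (f : d.+1.-tuple T -> R) (P : pred (d.+1.-tuple T)) :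
  \sum_(n : d.+1.-tuple T | P n) f n
  = \sum_(i : T) \sum_(n : d.-tuple T | P [tuple of i :: n]) f [tuple of i :: n].
Proof.
rewrite pair_big_dep /= (reindex (fun x : T * d.-tuple T => [tuple of x.1 :: x.2])) //=.
exists (fun n => (thead n, [tuple of behead n])) => [[i n] _|n _] /=.
  by congr (_, _); apply: val_inj.
by case/tupleP: n => i n; apply: val_inj.
Qed.

(** The bound m is freed from p because, once n_1 is chosen, the other indices lie below n_1 while
    still ranging over ['I_p]. *)
Lemma euler_sum_rec p d (s : d.-tuple eindex) m : all is_index s -> (0 < m <= p)%N ->
  \sum_(n : d.-tuple 'I_p | path gtn m (rcons [seq val i | i <- n] 0%N))
    \prod_(j < d) (esgn _ (tnth s j) ^+ (tnth n j : nat)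
                   / (tnth n j : nat)%:R ^+ eabs (tnth s j)) = hsum 'F_p s m.
Proof.
elim: d s m => [|d IHd] s m sP /andP[m0 mp].
  rewrite (tuple0 s) /= (big_pred1 [tuple]) => [|n]; first by rewrite big_ord0.
  by rewrite (tuple0 n) /= m0 eqxx.
case/tupleP: s sP => a s /= /andP[a0 sP].
rewrite big_cons_tuple /= big_mkord.
rewrite (big_ord_widen p (fun n => term 'F_p a n * hsum 'F_p s n) mp).
rewrite [RHS]big_mkcond; apply: eq_bigr => i _.
have [im|im] := ltnP i m; last by rewrite big_pred0.
(* No chain has n_1 = 0, and [term a 0] is 0 as well. *)
have [i0|i0] := posnP i.
  rewrite i0 term0 // mul0r big_pred0 // => n.
  by case: (rcons _ _) (size_rcons [seq val i | i <- n] 0%N).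
rewrite -IHd // ?i0 1?ltnW // mulr_sumr; apply: eq_bigr => n _.
by rewrite big_ord_recl !tnth0 /term; congr (_ * _); apply: eq_bigr => j _; rewrite !tnthS.
Qed.

Definition zeta (u : word) : calA := toA (fun p => hsum 'F_(val p) u (val p)).

Lemma zetaAE d (s : d.-tuple eindex) : all is_index s -> zetaA s = zeta s.
Proof.
move=> sP; congr toA; apply: prodFpP => p; apply: euler_sum_rec => //.
by rewrite prime_gt0 ?leqnn //; apply: valP.
Qed.

Lemma toA_sum (I : Type) (s : seq I) (f : I -> prodFp) :
  toA (fun p => \sum_(i <- s) f i p) = \sum_(i <- s) toA (f i).
Proof.
elim: s => [|i s IHs].
  rewrite big_nil -[RHS](rmorph0 (\pi_({ideal_quot directsum}))).
  by congr toA; apply: prodFpP => p; rewrite big_nil.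
rewrite big_cons -IHs -toAD; congr toA; apply: prodFpP => p.
by rewrite big_cons.
Qed.

Lemma zeta_nil : zeta [::] = 1.
Proof. by rewrite -[RHS](rmorph1 (\pi_({ideal_quot directsum}))). Qed.

Lemma zeta_stuffle u v : zeta u * zeta v = \sum_(w <- stuffle u v) zeta w.
Proof.
rewrite -toA_sum -toAM; congr toA; apply: prodFpP => p.
by rewrite -hsum_stuffle.
Qed.

Lemma word_signE p v : word_sign p v = (-1) ^+ sign_exp v.
Proof.
rewrite /word_sign /sign_exp; elim: v => [|a v IHv]; first by rewrite big_nil.
by rewrite big_cons IHv /= exprD /esign esgnE exprD.
Qed.

Lemma toA_sign k (f : prodFp) : toA (fun p => (-1) ^+ k * f p) = (-1) ^+ k * toA f.
Proof.
have -> : (fun p : primeT => (-1) ^+ k * f p) = (fun p => (-1) ^+ odd k * f p).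
  by apply: prodFpP => p; rewrite signr_odd.
rewrite -signr_odd; case: (odd k); last first.
  by rewrite mul1r; congr toA; apply: prodFpP => p; rewrite mul1r.
rewrite mulN1r -[RHS](rmorphN (\pi_({ideal_quot directsum}))).
by congr toA; apply: prodFpP => p; rewrite mulN1r.
Qed.

Lemma zeta_shuffle u v : all is_index u -> all is_index v ->
  \sum_(w <- shuffle u v) zeta w = (-1) ^+ sign_exp v * zeta (catrev v u).
Proof.
move=> uP vP; rewrite -toA_sum.
rewrite -toA_sign; congr toA; apply: prodFpP => p.
by rewrite hsum_shuffle // ?word_signE //; apply: valP.
Qed.

End EulerSums.

(** * Values of rows and soundness of the elimination *)

Section Rows.
Implicit Types (x y : word_row) (u v : word) (c d : Z).

Definition ratZ c : rat := (int_of_Z c)%:~R.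

Lemma ratZD c d : ratZ (Z.add c d) = ratZ c + ratZ d.
Proof. by rewrite /ratZ -intrD -(rmorphD int_of_Z). Qed.

Lemma ratZM c d : ratZ (Z.mul c d) = ratZ c * ratZ d.
Proof. by rewrite /ratZ -intrM -(rmorphM int_of_Z). Qed.

Lemma ratZ_eq0 c : ratZ c = 0 -> c = Z0.
Proof.
move=> /eqP; rewrite intr_eq0 => /eqP c0.
by rewrite -[c]int_of_ZK c0.
Qed.

Lemma word_cmp_eq u v : word_cmp u v = Eq -> u = v.
Proof.
elim: u v => [|a u IHu] [|b v] //=; rewrite /index_cmp.
case: (PeanoNat.Nat.compare_spec (eabs b) (eabs a)) => //.
by case: a b => [k|k] [l|l] //= -> /IHu ->.
Qed.

Definition eval x : calA := \sum_(t <- x) ratZ t.1 *: zeta t.2.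

Lemma eval_cons c u x : eval ((c, u) :: x) = ratZ c *: zeta u + eval x.
Proof. by rewrite /eval big_cons. Qed.

Lemma eval_nil : eval [::] = 0. Proof. by rewrite /eval big_nil. Qed.

Lemma eval_add x y : eval (add_rows x y) = eval x + eval y.
Proof.
elim: x y => [|[c u] x IHx] y; first by rewrite eval_nil add0r.
elim: y => [|[d v] y IHy]; first by rewrite eval_nil addr0.
rewrite [add_rows _ _]/=; case uv : (word_cmp u v); rewrite ?eval_cons.
- have {uv} <- := word_cmp_eq uv; have cd := ratZD c d.
  case: ifP => [/Z.eqb_spec e|_]; rewrite ?eval_cons IHx.
    by rewrite addrACA -scalerDl -cd e scale0r add0r.
  by rewrite addrACA -scalerDl -cd.
- by rewrite IHx eval_cons addrA.
- by rewrite [eval _]IHy eval_cons addrCA.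
Qed.

Arguments add_rows : simpl never.
Arguments scale_row : simpl never.

Lemma eval_scale c x : eval (scale_row c x) = ratZ c *: eval x.
Proof.
rewrite /eval big_map scaler_sumr; apply: eq_bigr => t _.
by rewrite ratZM scalerA.
Qed.

Lemma eval_words (s : seq word) : eval (row_of_words s) = \sum_(u <- s) zeta u.
Proof.
elim: s => [|u s IHs] /=; first by rewrite big_nil eval_nil.
by rewrite eval_add IHs big_cons eval_cons eval_nil addr0 scale1r.
Qed.

Lemma eval_mul u x : eval (mul_row u x) = zeta u * eval x.
Proof.
elim: x => [|[c v] x IHx] /=; first by rewrite eval_nil mulr0.
rewrite eval_add IHx eval_scale eval_words eval_cons mulrDr -zeta_stuffle.
by rewrite scalerAr.
Qed.

Lemma eval_prod (s : seq word) : eval (prod_row s) = \prod_(u <- s) zeta u.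
Proof.
elim: s => [|u s IHs] /=; last by rewrite eval_mul IHs big_cons.
by rewrite big_nil eval_cons eval_nil addr0 scale1r zeta_nil.
Qed.

Lemma eval_shuffle u v : eval (shuffle_row u v) = 0.
Proof.
rewrite /shuffle_row; case: ifP => [/andP[uP vP]|_]; last exact: eval_nil.
rewrite eval_add eval_words zeta_shuffle // eval_cons eval_nil addr0 -signr_odd.
by case: odd; rewrite /ratZ /= ?scaleN1r ?scale1r ?mulN1r ?mul1r ?addNr ?addrN.
Qed.

Lemma eval_relation w x : x \in relation_rows w -> eval x = 0.
Proof.
have shuf0 j k y : y \in shuffle_rows j k -> eval y = 0.
  by case/allpairsP => -[u v] [_ _ ->]; apply: eval_shuffle.
rewrite mem_cat => /orP[/flatten_mapP[j _]|]; first exact: shuf0.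
case/allpairsP=> -[u y] [_ yP ->] /=; rewrite eval_mul.
suff -> : eval y = 0 by rewrite mulr0.
by move: yP; rewrite mem_cat => /orP[]; apply: shuf0.
Qed.

Variable P : calA -> Prop.
Hypothesis P0 : P 0.
Hypothesis PD : forall f g, P f -> P g -> P (f + g).
Hypothesis PZ : forall (c : rat) f, P f -> P (c *: f).

(** [P] will be membership in the span of the generators; elimination only forms linear combinations
    of rows. *)
Lemma insert_row_sound ps x : (forall p, p \in ps -> P (eval p)) -> P (eval x) ->
  forall p, p \in insert_row ps x -> P (eval p).
Proof.
elim: ps x => [|q ps IHps] x psP xP p.
  by case: x xP => //= t x xP; rewrite inE => /eqP ->.
have qP : P (eval q) by apply: psP; rewrite mem_head.
have tlP r : r \in ps -> P (eval r) by move=> rps; apply: psP; rewrite inE rps orbT.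
case: q psP qP => [|[d v] q] psP qP /=; first by case: x xP => [|t x] _; apply: psP.
case: x xP => [|[c u] x] xP; first exact: psP.
case: word_cmp => /=.
- rewrite inE => /orP[/eqP -> //|]; apply: IHps => //.
  by rewrite eval_add !eval_scale; apply: PD; apply: PZ.
- by rewrite inE => /orP[/eqP -> //|]; apply: psP.
- by rewrite inE => /orP[/eqP -> //|]; apply: IHps.
Qed.

Lemma echelon_sound rs : (forall p, p \in rs -> P (eval p)) ->
  forall p, p \in echelon rs -> P (eval p).
Proof.
rewrite /echelon; have : forall p, p \in Nil word_row -> P (eval p) by [].
elim: rs [::] => //= r rs IHrs ps psP rsP; apply: IHrs => [|p prs].
  by apply: insert_row_sound => //; apply: rsP; rewrite mem_head.
by apply: rsP; rewrite inE prs orbT.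
Qed.

(** Back substitution: the tail of the row involves only words already known to satisfy [P], so it
    can be subtracted and the leading coefficient divided out. *)
Lemma solved_sound ps : (forall p, p \in ps -> P (eval p)) ->
  forall u, u \in solved ps -> P (zeta u).
Proof.
elim: ps => //= p ps IHps psP.
have sP : forall u, u \in solved ps -> P (zeta u).
  by apply: IHps => q qps; apply: psP; rewrite inE qps orbT.
have := psP _ (mem_head _ _); case: p psP => [|[c u] p] psP; first by [].
case: ifP => // /andP[/Z.eqb_spec c0 /allP pP] cupP v.
rewrite inE => /orP[/eqP ->|]; last exact: sP.
have c0' : ratZ c != 0 by apply/eqP => /ratZ_eq0.
have -> : zeta u = (ratZ c)^-1 *: (eval ((c, u) :: p) + (-1) *: eval p).
  by rewrite eval_cons scaleN1r addrK scalerA mulVf // scale1r.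
apply/PZ/PD/PZ => //; rewrite /eval big_seq; elim/big_ind: _ => // t tp.
by apply/PZ/sP/pP.
Qed.

Lemma full_rank_sound w : full_rank w ->
  (forall s, s \in gens w -> P (\prod_(u <- s) zeta u)) ->
  forall u, u \in words w -> P (zeta u).
Proof.
move=> /allP wP gP u /wP; apply: solved_sound; apply: echelon_sound => p.
rewrite mem_cat => /orP[/eval_relation -> //|/mapP[s /gP sP ->]].
by rewrite eval_prod.
Qed.

End Rows.

Definition word_weight (u : word) : nat := sumn (map eabs u).

Lemma mem_words u : all is_index u -> u \in words (word_weight u).
Proof.
move: {2}(word_weight u) (erefl (word_weight u)) => w.
elim: w u => [|w IHw] [|a u] uw //=.
  by case: a uw => -[|k].
move: uw => /[dup] uw -> /andP[a0 uP].
case: w IHw uw => [|w] IHw uw.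
  case: u uP uw => [|b u] /=.
    by case: a a0 => k; rewrite /word_weight /= addn0 => _ _ [->]; rewrite !inE eqxx ?orbT.
  by case: a a0 => -[|k] //; case: b => -[|l] //= _ _; rewrite /word_weight /= !addSn !addnS.
apply/flatten_mapP.
case: a a0 uw => -[//|[|k]] _; rewrite /word_weight /= => -[uw].
- by exists u; rewrite ?inE ?eqxx //; have := IHw u uw uP; rewrite (uw : word_weight u = _).
- exists (Plain k.+1 :: u); rewrite ?inE ?eqxx ?orbT //.
  by have := IHw (Plain k.+1 :: u) (congr1 S uw) uP; rewrite [word_weight _](congr1 S uw).
- by exists u; rewrite ?inE ?eqxx ?orbT //; have := IHw u uw uP; rewrite (uw : word_weight u = _).
- exists (Bar k.+1 :: u); rewrite ?inE ?eqxx ?orbT //.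
  by have := IHw (Bar k.+1 :: u) (congr1 S uw) uP; rewrite [word_weight _](congr1 S uw).
Qed.

(** * Fermat quotients and Bernoulli numbers *)

Section FermatBernoulli.
Variable p : nat.
Hypothesis pr_p : prime p.
Local Notation F := 'F_p.

Lemma fact_neq0 n : (n < p)%N -> n`!%:R != 0 :> F.
Proof.
elim: n => [|n IHn] np; first exact: oner_neq0.
by rewrite factS natrM mulf_neq0 ?IHn ?(ltnW np) ?Fp_nat_neq0.
Qed.

Definition p_integral (r : rat) : bool := (denq r)%:~R != 0 :> F.

(** The reduced denominator divides d, being coprime to the reduced numerator. *)
Lemma p_integral_frac (n d : int) : d%:~R != 0 :> F -> p_integral (n%:~R / d%:~R).
Proof.
move=> dF; set x := n%:~R / d%:~R; apply: contraNneq dF => q0.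
have [->|d0] := eqVneq d 0; first by [].
have /dvdzP[k ->] : (denq x %| d)%Z; last by rewrite intrM q0 mulr0.
rewrite -(Gauss_dvdzr (n := numq x)); last first.
  by rewrite coprimezE coprime_sym coprime_num_den.
have -> : numq x * d = n * denq x; last exact: dvdz_mull.
apply: (@intr_inj rat); rewrite !intrM numqE mulrAC divfK ?intr_eq0 //.
Qed.

Lemma p_integralD r s : p_integral r -> p_integral s -> p_integral (r + s).
Proof.
move=> rF sF; rewrite -(divq_num_den r) -(divq_num_den s).
rewrite addf_div ?intr_eq0 ?denq_neq0 // -!intrM -intrD.
by apply: p_integral_frac; rewrite intrM mulf_neq0.
Qed.

Lemma p_integralM r s : p_integral r -> p_integral s -> p_integral (r * s).
Proof.
move=> rF sF; rewrite -(divq_num_den r) -(divq_num_den s).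
rewrite mulf_div -!intrM.
by apply: p_integral_frac; rewrite intrM mulf_neq0.
Qed.

Lemma p_integral_int (n : int) : p_integral n%:~R.
Proof. by rewrite /p_integral denq_int oner_eq0. Qed.

Lemma p_integral_natV n : n%:R != 0 :> F -> p_integral n%:R^-1.
Proof. by move=> nF; rewrite -div1r; apply: (@p_integral_frac 1 n%:Z). Qed.

Lemma rat_mod_int (n : int) : rat_mod p n%:~R = n%:~R.
Proof. exact: ratr_int. Qed.

Lemma rat_mod_natV n : n%:R != 0 :> F -> rat_mod p n%:R^-1 = n%:R^-1.
Proof.
move=> nF; rewrite /rat_mod (@ratr_fracE _ _ 1 n%:Z) ?mul1r //.
Qed.

Definition bern_coef k : F := rat_mod p (bernoulli k / k`!%:R).

(** This is [bernoulli_egf] at t^(k + 1), solved for its last term. *)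
Lemma bernoulli_rec k : bernoulli k / k`!%:R
  = (k == 0%N)%:R - \sum_(j < k) bernoulli j / j`!%:R * (k.+1 - j)`!%:R^-1.
Proof.
rewrite -[in RHS]eqSS -(bernoulli_egf k.+1) big_ord_recr /=.
by rewrite subSnn invr1 mulr1 addrAC subrr add0r.
Qed.

Lemma bern_sum_integral k n : (n < p)%N -> (k <= n)%N ->
  (forall j, (j < k)%N -> p_integral (bernoulli j / j`!%:R)) ->
  let S := \sum_(j < k) bernoulli j / j`!%:R * (n - j)`!%:R^-1 in
  p_integral S /\ rat_mod p S = \sum_(j < k) bern_coef j * (n - j)`!%:R^-1.
Proof.
move=> np; elim: k => [|k IHk] kn jP /=.
  rewrite !big_ord0; split; first exact: (p_integral_int 0).
  exact: (rat_mod_int 0).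
have [||sP sE] := IHk; [exact: ltnW | by move=> j jk; apply: jP; apply: ltnW |].
have fF : (n - k)`!%:R != 0 :> F.
  by apply: fact_neq0; apply: leq_ltn_trans np; apply: leq_subr.
have tP := p_integralM (jP k (ltnSn k)) (p_integral_natV fF).
rewrite !big_ord_recr /=; split; first exact: p_integralD.
rewrite rat_modD // sE rat_modM ?rat_mod_natV //; first exact: jP.
exact: p_integral_natV.
Qed.

(** The recursion divides only by factorials up to (k + 1)!, all prime to p; von Staudt-Clausen is
    avoided. *)
Lemma bernoulli_integral k : (k.+1 < p)%N -> p_integral (bernoulli k / k`!%:R).
Proof.
elim/ltn_ind: k => k IHk kp; rewrite bernoulli_rec.
have [|sP _] := @bern_sum_integral k k.+1 kp (leqnSn k).
  by move=> j jk; apply: IHk => //; apply: ltn_trans kp.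
apply: p_integralD; first exact: (p_integral_int (k == 0%N)%:Z).
rewrite -mulN1r; apply: p_integralM => //; exact: (p_integral_int (-1)).
Qed.

Lemma p_integral_bernoulli k : (k.+1 < p)%N -> p_integral (bernoulli k).
Proof.
move=> kp; have k0 : k`!%:R != 0 :> rat by rewrite pnatr_eq0 -lt0n fact_gt0.
rewrite -(divfK k0 (bernoulli k)); apply: p_integralM; first exact: bernoulli_integral.
exact: (p_integral_int k`!%:Z).
Qed.

Lemma bern_coef_sum n : (n < p)%N ->
  \sum_(j < n) bern_coef j * (n - j)`!%:R^-1 = (n == 1%N)%:R.
Proof.
move=> np; have [|_ <-] := @bern_sum_integral n n np (leqnn n).
  by move=> j jn; apply: bernoulli_integral; apply: leq_ltn_trans np.
by rewrite bernoulli_egf; apply: (rat_mod_int (n == 1%N)%:Z).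
Qed.

Lemma divided_binomial (x : F) N : (N < p)%N ->
  (x + 1) ^+ N / N`!%:R = \sum_(i < N.+1) x ^+ i / i`!%:R / (N - i)`!%:R.
Proof.
move=> Np; rewrite addrC exprDn mulr_suml; apply: eq_bigr => i _.
have iN : (i <= N)%N by rewrite -ltnS.
have iF := fact_neq0 (leq_ltn_trans iN Np).
have NiF : (N - i)`!%:R != 0 :> F by apply: fact_neq0; apply: leq_ltn_trans (leq_subr _ _) Np.
have NF := fact_neq0 Np.
rewrite expr1n mul1r -(bin_fact iN) -mulr_natr !natrM.
have bF : 'C(N, i)%:R != 0 :> F.
  by apply: contraNneq NF => b0; rewrite -(bin_fact iN) natrM b0 mul0r.
by field; rewrite bF iF NiF.
Qed.

(* Faulhaber's formula with divided powers, which avoids binomial coefficients. *)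
Lemma power_sum n e : (e.+1 < p)%N ->
  \sum_(0 <= m < n) (m%:R : F) ^+ e / e`!%:R
  = \sum_(k < e.+1) bern_coef k * (n%:R ^+ (e.+1 - k) / (e.+1 - k)`!%:R).
Proof.
move=> ep; elim: n => [|n IHn].
  rewrite big_geq // big1 // => k _.
  by rewrite subSn -1?ltnS // expr0n mul0r mulr0.
rewrite big_nat_recr //= {}IHn; apply/eqP; rewrite addrC eq_sym -subr_eq -sumrB; apply/eqP.
transitivity (\sum_(k < e.+1) \sum_(i < e.+1 | (i < e.+1 - k)%N)
    bern_coef k * (n%:R ^+ i / i`!%:R / (e.+1 - k - i)`!%:R)).
  apply: eq_bigr => k _; rewrite -mulrBr -[n.+1]addn1 natrD divided_binomial; last first.
    by apply: leq_ltn_trans ep; apply: leq_subr.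
  rewrite big_ord_recr /= subnn divr1 addrK -mulr_sumr; congr (_ * _).
  by rewrite (big_ord_widen e.+1 (fun i => n%:R ^+ i / i`!%:R / (e.+1 - k - i)`!%:R)) // leq_subr.
(* For fixed i the sum over k is the Bernoulli recurrence, equal to 1 for i = e and to 0
   otherwise. *)
rewrite (exchange_big_dep xpredT) //=.
transitivity (\sum_(i < e.+1) n%:R ^+ i / i`!%:R * ((e.+1 - i)%N == 1%N)%:R : F).
  apply: eq_bigr => i _; rewrite -bern_coef_sum; last first.
    by apply: leq_ltn_trans ep; apply: leq_subr.
  rewrite mulr_sumr (big_ord_widen e.+1 (fun k =>
    n%:R ^+ i / i`!%:R * (bern_coef k / (e.+1 - i - k)`!%:R))) ?leq_subr //.
  apply: eq_big => k; first by apply/idP/idP; lia.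
  by move=> _; rewrite subnAC; ring.
rewrite big_ord_recr /= subSnn eqxx mulr1 big1 ?add0r // => i _.
have -> : (e.+1 - i == 1)%N = false by have := ltn_ord i; lia.
by rewrite mulr0.
Qed.

(* Take n = p in Faulhaber's formula. *)
Lemma power_sum_Fp j : (j.+1 < p)%N ->
  \sum_(1 <= m < p) (m%:R : F) ^+ j = - (j == 0%N)%:R.
Proof.
move=> jp; have := power_sum p jp; rewrite [RHS]big1 => [|k _]; last first.
  by rewrite pchar_Fp_0 // subSn -1?ltnS // expr0n mul0r mulr0.
rewrite -mulr_suml => /eqP; rewrite mulf_eq0 invr_eq0 (negPf (fact_neq0 (ltnW jp))) orbF.
rewrite big_ltn ?prime_gt0 // expr0n addrC => /eqP e.
by apply/eqP; rewrite -addr_eq0 e.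
Qed.

Lemma Fp_expp1 n : (0 < n < p)%N -> (n%:R : F) ^+ p.-1 = 1.
Proof.
move=> np; apply: (mulfI (Fp_nat_neq0 pr_p np)).
rewrite mulr1 -exprS prednK ?prime_gt0 //.
by rewrite -[RHS](expf_card) card_Fp.
Qed.

(** By Fermat, 1/m^(w-1) = m^(p-w). Faulhaber's formula sums these below n; after division by n the
    outer sum runs over n^(p-w-k) and vanishes unless k = p - w. *)
Lemma hsum_bernoulli w : (1 < w < p)%N ->
  hsum F [:: Plain 1; Plain w.-1] p = - rat_mod p (bernoulli (p - w)).
Proof.
case/andP=> w1 wp; set e := (p - w)%N.
have ep : (e.+1 < p)%N by rewrite /e; lia.
have eF : e`!%:R != 0 :> F by apply: fact_neq0; apply: ltnW.
have eE : rat_mod p (bernoulli e) = e`!%:R * bern_coef e.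
  rewrite /bern_coef -[e`!%:R in RHS](rat_mod_int e`!%:Z) -rat_modM.
  - by congr rat_mod; rewrite mulrC divfK // pnatr_eq0 -lt0n fact_gt0.
  - exact: p_integral_int.
  - exact: bernoulli_integral.
have termE m : (m < p)%N -> term F (Plain w.-1) m = m%:R ^+ e.
  move=> mp; rewrite /term /= expr1n mul1r.
  (* At m = 0 both sides are 0, as w - 1 and p - w are positive. *)
  have [->|m0] := posnP m.
    have -> : 0%:R ^+ w.-1 = 0 :> F by rewrite expr0n (_ : w.-1 == 0%N = false) //; lia.
    by rewrite invr0 expr0n (_ : e == 0%N = false) // /e; lia.
  have mF : m%:R != 0 :> F by apply: Fp_nat_neq0; rewrite ?m0.
  apply: (mulIf (expf_neq0 w.-1 mF)); rewrite mulVf ?expf_neq0 // -exprD.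
  rewrite (_ : (e + w.-1 = p.-1)%N); last by rewrite /e; lia.
  by rewrite Fp_expp1 ?m0.
have p0 := prime_gt0 pr_p.
rewrite /= big_ltn // term0 // mul0r add0r.
transitivity (\sum_(1 <= n < p) \sum_(k < e.+1)
    e`!%:R * bern_coef k / (e.+1 - k)`!%:R * (n%:R : F) ^+ (e - k)).
  rewrite !big_nat; apply: eq_bigr => n /andP[n0 np].
  have nF : n%:R != 0 :> F by apply: Fp_nat_neq0; rewrite ?n0.
  rewrite (eq_big_nat _ _ (F2 := fun m => e`!%:R * (m%:R ^+ e / e`!%:R))).
    rewrite -mulr_sumr power_sum // !mulr_sumr; apply: eq_bigr => k _.
    rewrite subSn -1?ltnS // exprS /term /= expr1n expr1 mul1r.
    by field; rewrite nF fact_neq0 //; lia.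
  by move=> m /andP[_ mn]; rewrite mulr1 termE ?(ltn_trans mn) // mulrC divfK.
rewrite exchange_big /=.
transitivity (\sum_(k < e.+1) e`!%:R * bern_coef k / (e.+1 - k)`!%:R * - ((e - k)%N == 0%N)%:R).
  apply: eq_bigr => k _; rewrite -mulr_sumr power_sum_Fp //; lia.
rewrite big_ord_recr /= subSnn subnn eqxx divr1 mulrN1 -eE big1 ?add0r // => k _.
by rewrite subn_eq0 leqNgt ltn_ord oppr0 mulr0.
Qed.

(** Since p divides C(p, k + 1), Pascal's rule makes consecutive binomials opposite. *)
Lemma bin_pred_prime k : (k < p)%N -> 'C(p.-1, k)%:R = (-1) ^+ k :> F.
Proof.
elim: k => [|k IHk] kp; first by rewrite bin0.
have /eqP : 'C(p, k.+1)%:R = 0 :> F.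
  by apply/eqP; rewrite -(dvdn_pcharf (pchar_Fp pr_p)) prime_dvd_bin.
have -> : 'C(p, k.+1) = ('C(p.-1, k.+1) + 'C(p.-1, k))%N.
  by rewrite -binS prednK ?prime_gt0.
rewrite natrD IHk 1?ltnW // addr_eq0 => /eqP ->.
by rewrite exprS mulN1r.
Qed.

(** The sum of C(p, k)/p over 0 < k < p is (2^p - 2)/p, twice the Fermat quotient, and modulo p its
    terms are those of the Euler sum up to sign. *)
Lemma hsum_fermat : (2 < p)%N ->
  hsum F [:: Bar 1] p = - 2%:R * rat_mod p ((2 ^+ p.-1 - 1) / p%:R).
Proof.
move=> p2; have p0 := prime_gt0 pr_p.
have [q qE] : exists q, (2 ^ p.-1 = (q * p).+1)%N.
  have : (p %| 2 ^ p.-1 - 1)%N.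
    rewrite (dvdn_pcharf (pchar_Fp pr_p)) natrB ?expn_gt0 // natrX.
    by rewrite Fp_expp1 ?subrr.
  by case/dvdnP => q qE; exists q; have := expn_gt0 2 p.-1; lia.
have -> : (2 ^+ p.-1 - 1) / p%:R = q%:~R :> rat.
  rewrite -natrX qE -addn1 natrD addrK natrM mulfK // pnatr_eq0 -lt0n //.
rewrite rat_mod_int.
have binE k : (0 < k < p)%N -> ('C(p, k) %/ p)%:R = - ((-1) ^+ k / k%:R) :> F.
  move=> kp; have kF := Fp_nat_neq0 pr_p kp; case/andP: kp => k0 kp.
  apply: (mulfI kF); rewrite mulrN mulrCA mulfV // mulr1.
  have dv : (p %| 'C(p, k))%N by apply: prime_dvd_bin => //; rewrite k0.
  have e : (k * ('C(p, k) %/ p) = 'C(p.-1, k.-1))%N.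
    apply/eqP; rewrite -(eqn_pmul2l p0) mulnCA [(p * _)%N in X in X == _]mulnC divnK //.
    by case: (k) k0 => // k' _; rewrite mul_bin_diag.
  rewrite -natrM e bin_pred_prime; last by lia.
  by case: (k) k0 => // k' _; rewrite exprS mulN1r opprK.
have -> : hsum F [:: Bar 1] p = - \sum_(1 <= k < p) ('C(p, k) %/ p)%:R.
  rewrite /= big_ltn // term0 // mul0r add0r -sumrN !big_nat.
  by apply: eq_bigr => k kp; rewrite binE // opprK /term /= expr1 mulr1.
rewrite -natr_sum mulNr; congr (- _); rewrite -[q%:~R]/(q%:R) -natrM; congr (_%:R).
apply/eqP; rewrite -(eqn_pmul2l p0) big_distrr /=; apply/eqP.
have -> : (\sum_(1 <= k < p) p * ('C(p, k) %/ p) = \sum_(1 <= k < p) 'C(p, k))%N.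
  rewrite !big_nat; apply: eq_bigr => k kp.
  by rewrite mulnC divnK // prime_dvd_bin.
have : (2 ^ p = \sum_(0 <= k < p.+1) 'C(p, k))%N.
  rewrite big_mkord (Pascal 1 1 p); apply: eq_bigr => k _; by rewrite !exp1n !muln1.
rewrite big_nat_recr //= big_ltn // bin0 binn -{1}(prednK p0) expnS qE; lia.
Qed.

End FermatBernoulli.

(** * Spans in the algebra A *)

Section Span.
Local Open Scope classical_set_scope.

Lemma zeta_fermat : zeta [:: Bar 1] = (- 2%:R) *: q2.
Proof.
rewrite scale_toA; apply/toAP.
(* The only exceptional prime is 2. *)
apply: sub_finite_set (finite_dvd_primes (isT : 0 < 2)%N) => p; rewrite /mkset.
apply: contraNT => p2; apply/eqP.
have {}p2 : (2 < val p)%N.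
  rewrite ltn_neqAle prime_gt1 ?andbT; last exact: valP.
  by apply: contraNneq p2 => <-.
rewrite hsum_fermat //; last exact: valP.
by rewrite /prodFp_scale; congr (_ * _); rewrite [RHS](rat_mod_int _ (- 2%:Z)).
Qed.

Lemma zeta_bernoulli w : (1 < w)%N ->
  zeta [:: Plain 1; Plain w.-1] = (- w%:R) *: beta w.
Proof.
move=> w1; rewrite scale_toA; apply/toAP.
(* The exceptional primes p <= w are the divisors of w!. *)
apply: sub_finite_set (finite_dvd_primes (fact_gt0 w)) => p; rewrite /mkset.
have pr_p : prime (val p) := valP p.
apply: contraNT => pw; apply/eqP.
have wp : (w < val p)%N.
  rewrite ltnNge; apply: contra pw => pw.
  by rewrite -(dvdn_pcharf (pchar_Fp pr_p)) dvdn_fact // prime_gt0.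
have wF : w%:R != 0 :> 'F_(val p) by apply: Fp_nat_neq0; rewrite ?wp ?andbT // ltnW.
rewrite hsum_bernoulli ?w1 // /prodFp_scale wp.
have -> : rat_mod (val p) (- w%:R) = - w%:R.
  by have := rat_mod_int (val p) (- w%:Z); rewrite !intrN.
rewrite rat_modM.
- by rewrite rat_mod_natV // mulNr mulrCA mulfV // mulr1.
- by apply: p_integral_bernoulli => //; lia.
- exact: p_integral_natV.
Qed.

Variable V : lmodType rat.
Implicit Type S : set V.

Lemma Qspan_gen S x : S x -> Qspan S x.
Proof.
by move=> Sx; exists 1%N, (fun=> 1), (fun=> x); rewrite big_ord1 scale1r.
Qed.

Lemma Qspan0 S : Qspan S 0.
Proof. by exists 0%N, (fun=> 0), (fun=> 0); split=> [[]//|]; rewrite big_ord0. Qed.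

Lemma QspanZ S a x : Qspan S x -> Qspan S (a *: x).
Proof.
case=> n [c [v [Sv ->]]]; exists n, (fun i => a * c i), v; split=> //.
by rewrite scaler_sumr; apply: eq_bigr => i _; rewrite scalerA.
Qed.

Lemma QspanD S x y : Qspan S x -> Qspan S y -> Qspan S (x + y).
Proof.
case=> n [c [v [Sv ->]]] [m [d [u [Su ->]]]].
exists (n + m)%N, (fun i => match split i with inl j => c j | inr j => d j end),
  (fun i => match split i with inl j => v j | inr j => u j end); split.
  by move=> i; case: split.
rewrite big_split_ord /=; congr (_ + _); apply: eq_bigr => i _.
  by rewrite (unsplitK (inl i)).
by rewrite (unsplitK (inr i)).
Qed.

Lemma Qspan_min S S' : (forall x, S x -> Qspan S' x) -> Qspan S `<=` Qspan S'.
Proof.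
move=> SS' _ [n [c [v [Sv ->]]]]; elim/big_ind: _ => [|x y|i _].
- exact: Qspan0.
- exact: QspanD.
- exact/QspanZ/SS'.
Qed.

End Span.

(** * Generators as rational multiples of Euler sums, and the conclusion *)

Definition gen_value (u : word) : calA :=
  if u == [:: Bar 1] then q2 else
  if u == [:: Plain 1; Plain 2] then beta 3 else
  if u == [:: Plain 1; Plain 4] then beta 5 else zeta u.

(** Nonzero factors do not change spans, so the words (bar 1), (1, 2) and (1, 4) can stand for [q2],
    [beta 3] and [beta 5] in the computation. *)
Lemma zeta_gen_value u : exists2 k : rat, k != 0 & zeta u = k *: gen_value u.
Proof.
rewrite /gen_value; case: eqP => [->|_]; first by exists (- 2%:R); last exact: zeta_fermat.
case: eqP => [->|_]; first by exists (- 3%:R); last exact: (@zeta_bernoulli 3).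
case: eqP => [->|_]; first by exists (- 5%:R); last exact: (@zeta_bernoulli 5).
by exists 1; rewrite ?scale1r.
Qed.

Lemma prod_gen_value (s : seq word) : exists2 k : rat, k != 0 &
  \prod_(u <- s) zeta u = k *: \prod_(u <- s) gen_value u.
Proof.
elim: s => [|u s [k k0 IHs]]; first by exists 1; rewrite ?big_nil ?scale1r.
have [l l0 uE] := zeta_gen_value u; exists (l * k); first by rewrite mulf_neq0.
by rewrite !big_cons IHs uE -scalerAl -scalerAr scalerA.
Qed.

Definition homogeneous (w : nat) (x : word_row) : bool :=
  all (fun t => all is_index t.2 && (word_weight t.2 == w)) x.

Lemma weightE d (s : d.-tuple eindex) : weight s = word_weight s.
Proof. by rewrite /weight /word_weight sumnE big_map big_tuple. Qed.

Lemma FES_zeta w u : all is_index u -> word_weight u = w -> FES w (zeta u).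
Proof.
move=> uP uw; apply: Qspan_gen; exists (size u), (in_tuple u); split=> //.
  by rewrite weightE.
by rewrite zetaAE.
Qed.

Lemma FES_homogeneous w x : homogeneous w x -> FES w (eval x).
Proof.
move=> /allP xP; rewrite /eval big_seq; elim/big_ind: _ => [|f g|t /xP/andP[tP /eqP tw]].
- exact: Qspan0.
- exact: QspanD.
- exact/QspanZ/FES_zeta.
Qed.

(** [full_rank] puts the Euler sums into the span. Conversely, homogeneity of the stuffle expansions
    puts each product of generators into [FES w]. *)
Lemma FES_gens w (G : set calA) :
  (forall x, G x <-> exists2 s, s \in gens w & x = \prod_(u <- s) gen_value u) ->
  full_rank w -> all (homogeneous w) (map prod_row (gens w)) -> FES w = Qspan G.
Proof.
move=> GE rk /allP hom; apply/seteqP; split; apply: Qspan_min => x.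
  case=> d [s [sP sw ->]]; rewrite zetaAE //.
  apply: (full_rank_sound (P := Qspan G) _ _ _ rk).
  - exact: Qspan0.
  - exact: QspanD.
  - exact: QspanZ.
  - move=> t tw; have [k _ ->] := prod_gen_value t.
    by apply/QspanZ/Qspan_gen/GE; exists t.
  - by rewrite -sw weightE mem_words.
move=> /GE[s sw ->]; have [k k0 sE] := prod_gen_value s.
have -> : \prod_(u <- s) gen_value u = k^-1 *: eval (prod_row s).
  by rewrite eval_prod sE scalerA mulVf // scale1r.
by apply/QspanZ/FES_homogeneous/hom/map_f.
Qed.

Lemma full_rank_le6 :
  all (fun w => full_rank w && all (homogeneous w) (map prod_row (gens w))) (iota 1 6).
Proof. by vm_compute. Qed.

Local Open Scope classical_set_scope.

Theorem theorem3p10 :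
  FES 1 = Qspan [set q2] /\
  FES 2 = Qspan [set q2 ^+ 2] /\
  FES 3 = Qspan [set q2 ^+ 3; beta 3] /\
  FES 4 = Qspan [set q2 ^+ 4; q2 * beta 3; zetaA [tuple Plain 1; Bar 3]] /\
  FES 5 = Qspan [set q2 ^+ 5; q2 ^+ 2 * beta 3; beta 5;
                     zetaA [tuple Bar 1; Plain 2; Plain 2];
                     zetaA [tuple Bar 1; Bar 2; Plain 2]] /\
  FES 6 = Qspan [set q2 ^+ 6; q2 ^+ 3 * beta 3; beta 3 ^+ 2; q2 * beta 5;
                     zetaA [tuple Bar 1; Plain 1; Plain 2; Plain 2];
                     zetaA [tuple Bar 1; Plain 2; Plain 2; Plain 1];
                     zetaA [tuple Bar 1; Plain 2; Plain 1; Plain 2];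
                     zetaA [tuple Bar 1; Plain 1; Plain 1; Plain 1; Plain 2]].
Proof.
(* For a concrete w the [foldr] unfolds to a finite disjunction, which matches the explicit set of
   generators. *)
have FES_G w (G : set calA) : w \in iota 1 6 ->
    (forall x, G x <-> foldr (fun s Q => x = \prod_(u <- s) gen_value u \/ Q) False (gens w)) ->
    FES w = Qspan G.
  move=> /(allP full_rank_le6)/andP[rk hom] GE; apply: FES_gens => // x; rewrite GE.
  elim: (gens w) => [|t l IHl] /=; first by split=> // -[].
  rewrite IHl; split=> [[->|[s sl ->]]|[s]]; first by exists t; rewrite ?mem_head.
    by exists s; rewrite // inE sl orbT.
  by rewrite inE => /orP[/eqP -> ->|sl ->]; [left | right; exists s].
do ![split]; apply: FES_G => // x; rewrite /= !big_cons big_nil /gen_value /=.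
all: rewrite ?zetaAE // ?exprS ?expr0 ?mulr1 ?mulrA.
all: tauto.
Qed.
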